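(* Let $f,g\in S_-$. Then $f$ is conjugate to $g$ in $\mathrm{Diffeo}([0,+\infty))$ (that is, there is $h\in\mathrm{Diffeo}([0,+\infty))$ with $f=h^{-1}\circ g\circ h$) if and only if Condition (P) holds and there exist some $a>0$ and $\alpha>0$ for which $\Phi_+(a,\alpha)$ is $C^\infty$ at $0$ (i.e. its extension to $[0,+\infty)$ by the value $0$ at $0$ is infinitely differentiable on $[0,+\infty)$).
   Context: $\mathrm{Diffeo}([0,+\infty))$ is the group, under composition, of infinitely differentiable diffeomorphisms of $[0,+\infty)$ (derivatives at $0$ are one-sided). $S_-$ is the set of $f\in\mathrm{Diffeo}([0,+\infty))$ with $f(x)<x$ for all $x>0$. $f^{\circ n}$ denotes the $n$-th iterate of $f$. For $f,g\in S_-$, $x>0$, $\xi>0$ put $$H_1(x,\xi)=\prod_{n=0}^{\infty}\frac{f'(f^{\circ n}(x))}{g'(g^{\circ n}(\xi))}.$$ Condition (P): there exist $x>0$ and $\xi>0$ such that the product $H_1(x,\xi)$ converges to a nonzero limit. If Condition (P) holds, then $H_1(x,\xi)$ converges for all $x,\xi>0$ and is a smooth positive function on $(0,+\infty)\times(0,+\infty)$. For $a,\alpha,\lambda>0$ let $D_1(a,\alpha,\lambda)$ denote the initial-value problem $$\frac{d\phi}{dx}=H_1(x,\phi(x))\,\lambda,\qquad \phi(a)=\alpha .$$ For each $a,\alpha>0$ there is exactly one $\lambda>0$ for which the solution $\phi$ of $D_1(a,\alpha,\lambda)$ satisfies $\phi(f(a))=g(\alpha)$. This solution $\phi$ is denoted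 $\Phi_+(a,\alpha)$; it is defined on $(0,+\infty)$ and extends to a $C^1$ function on $[0,+\infty)$ with value $0$ at $0$. *)

(* Defs.v *)
From Stdlib Require Import Reals.
From Coquelicot Require Import Coquelicot.

Open Scope R_scope.

(* Self-maps of [0,+oo) are represented by total functions [R -> R] of which
   only the values on [0,+oo) matter. *)
Definition half_line (x : R) : Prop := 0 <= x.

(* [d n] is the [n]-th derivative of [f]. [D_in] is the derivative relative to
   the given domain, hence one-sided at 0. *)
Definition smooth (f : R -> R) : Prop :=
  exists d : nat -> R -> R,
    (forall x, half_line x -> d 0%nat x = f x) /\
    (forall n x, half_line x -> D_in (d n) (d (S n)) half_line x).

Definition inverse_maps (f finv : R -> R) : Prop :=
  forall x, half_line x ->
    half_line (f x) /\ half_line (finv x) /\ finv (f x) = x /\ f (finv x) = x.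

Definition diffeo_with_inverse (f finv : R -> R) : Prop :=
  inverse_maps f finv /\ smooth f /\ smooth finv.

Definition diffeo (f : R -> R) : Prop :=
  exists finv, diffeo_with_inverse f finv.

Definition S_minus (f : R -> R) : Prop :=
  diffeo f /\ forall x, 0 < x -> f x < x.

Definition conjugate (f g : R -> R) : Prop :=
  exists h hinv, diffeo_with_inverse h hinv /\
    forall x, half_line x -> f x = hinv (g (h x)).

(* For [x, xi > 0] the orbits stay in the open half-line, where [Derive] is
   the usual derivative and does not see the values of [f], [g] below 0. *)
Definition H1_partial (f g : R -> R) (x xi : R) (N : nat) : R :=
  prod_f_R0
    (fun n => Derive f (Nat.iter n f x) / Derive g (Nat.iter n g xi)) N.

(* Meaningful when the product converges; by convention [Lim_seq] and [real]
   return some real number otherwise. *)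
Definition H1 (f g : R -> R) (x xi : R) : R :=
  real (Lim_seq (H1_partial f g x xi)).

Definition condition_P (f g : R -> R) : Prop :=
  exists x xi : R, 0 < x /\ 0 < xi /\
    exists l : R, l <> 0 /\ is_lim_seq (H1_partial f g x xi) l.

(* [phi] must be positive because [H1 x xi] is only considered for [xi > 0]. *)
Definition solves_D1 (f g : R -> R) (a alpha lambda : R) (phi : R -> R) : Prop :=
  (forall x, 0 < x ->
     0 < phi x /\ is_derive phi x (H1 f g x (phi x) * lambda)) /\
  phi a = alpha.

(* "[phi] is Phi_+(a,alpha)". Under [condition_P] there is exactly one such
   [phi] up to its irrelevant values outside (0,+oo), for exactly one
   [lambda]. *)
Definition is_Phi_plus (f g : R -> R) (a alpha : R) (phi : R -> R) : Prop :=
  exists lambda : R, 0 < lambda /\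
    solves_D1 f g a alpha lambda phi /\ phi (f a) = g alpha.

Definition extend_by_0 (phi : R -> R) (x : R) : R :=
  if Rlt_dec 0 x then phi x else 0.

(* Main.v *)
Require Import Defs.
From Stdlib Require Import Reals Lra Lia Classical ClassicalEpsilon.
From Coquelicot Require Import Coquelicot.
Open Scope R_scope.

(** Differentiating [h o f = g o h] along orbits shows that for a conjugacy [h]
    the partial products at [(x, h x)] telescope to [h' x / h' (f^(N+1) x)].
    They therefore tend to [h' x / h' 0], which is (P), and the limit says that
    [h] itself solves the initial-value problem with [lambda = h' 0]
    ([conjugacy_is_Phi_plus]).

    For the converse, [phi = Phi_+(a, alpha)] is shown to be the conjugacy when
    its extension is smooth ([smooth_Phi_plus_conjugate]). Four facts are needed.

    Convergence. On bounded intervals [ln f'] is Lipschitz, and any point lies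
    in a bounded number of the intervals between [f^n x] and [f^n y], so that
    the product of [f' (f^n x) / f' (f^n y)] converges, uniformly on compact
    sets ([bounded_distortion]). These products form a cocycle: they propagate
    (P) to all base points ([H1_limit]) and separate the variables of the
    equation ([H1_separated]).

    Functional equation. Dropping the first factor gives
    [H1 (f x) (g xi) f' x = H1 x xi g' xi]. Hence [phi o f] and [g o phi] solve
    the same separable equation. They agree at [a], so they are equal
    ([Phi_plus_semiconjugates]).

    Positive derivative. Away from 0 the derivative of [phi] is
    [lambda H1 > 0]. Along an orbit it is [lambda] times the tail of a
    convergent product ([H1_along_orbits]), so that its limit at 0 is [lambda].

    Bijectivity. If [phi] were bounded, its supremum [s] would satisfy
    [s <= g s] ([semiconjugacy_unbounded]). A smooth unbounded function that vanishes
    at 0 and has positive derivative is a diffeomorphism of the half-line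
    ([unbounded_diffeo]). *)

(** * Calculus relative to the closed half-line *)

Lemma locally_pos (x : R) : 0 < x -> locally x (fun t => 0 < t).
Proof. intros Hx. apply (open_gt 0 x Hx). Qed.

Definition derivative_sequence (f : R -> R) (d : nat -> R -> R) : Prop :=
  (forall x, half_line x -> d 0%nat x = f x) /\
  (forall n x, half_line x -> D_in (d n) (d (S n)) half_line x).

Lemma D_in_half_line_is_derive (f df : R -> R) (x : R) :
  0 < x -> D_in f df half_line x -> is_derive f x (df x).
Proof.
  intros Hx H. apply is_derive_Reals. intros eps Heps.
  destruct (H eps Heps) as [alp [Halp H']].
  assert (Hm : 0 < Rmin alp x) by (apply Rmin_case; lra).
  exists (mkposreal _ Hm). intros u Hu Hu'. simpl in Hu'.
  pose proof (Rmin_l alp x). pose proof (Rmin_r alp x).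
  assert (Hd : D_x half_line x (x + u) /\ Rdist (x + u) x < alp).
  { split.
    - split; [unfold half_line; apply Rabs_def2 in Hu'; lra | lra].
    - unfold Rdist. replace (x + u - x) with u by ring. lra. }
  specialize (H' (x + u) Hd).
  simpl in H'. unfold Rdist in H'.
  replace (x + u - x) with u in H' by ring. exact H'.
Qed.

Lemma D_in_half_line_unique (f d1 d2 : R -> R) (x : R) :
  half_line x -> D_in f d1 half_line x -> D_in f d2 half_line x -> d1 x = d2 x.
Proof.
  intros Hx H1 H2.
  refine (single_limit _ (D_x half_line x) _ _ x _ H1 H2).
  intros e He. exists (x + e / 2). unfold half_line in *. split.
  - split; unfold half_line; lra.
  - unfold Rdist. rewrite Rabs_pos_eq; lra.
Qed.

Lemma D_in_half_line_ext (f g df dg : R -> R) (x : R) :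
  (forall y, half_line y -> f y = g y) -> df x = dg x ->
  half_line x -> D_in f df half_line x -> D_in g dg half_line x.
Proof.
  intros Hfg Hd Hx H eps Heps. destruct (H eps Heps) as [alp [Halp H']].
  exists alp; split; [exact Halp|]. intros y Hy. specialize (H' y Hy).
  rewrite <- Hd, <- (Hfg x Hx), <- (Hfg y (proj1 (proj1 Hy))). exact H'.
Qed.

Lemma D_in_half_line_comp (f g df dg : R -> R) (x : R) :
  (forall y, half_line y -> half_line (f y)) -> half_line x ->
  D_in f df half_line x -> D_in g dg half_line (f x) ->
  D_in (fun y => g (f y)) (fun y => df y * dg (f y)) half_line x.
Proof.
  intros Hf Hx H1 H2.
  apply (D_in_imp _ _ (Dgf half_line half_line f)).
  - intros y Hy; split; auto.
  - apply Dcomp; assumption.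
Qed.

(** Freezing the function at its value at 0 on the negative axis turns
    one-sided continuity into continuity on [R], so that the theorems about
    continuous functions of a real variable apply. *)
Lemma continuity_freeze (f df : R -> R) :
  (forall x, half_line x -> D_in f df half_line x) ->
  continuity (fun x => f (Rmax 0 x)).
Proof.
  intros H x eps Heps.
  assert (Hx : half_line (Rmax 0 x)) by (apply Rmax_l).
  destruct (cont_deriv _ _ _ _ (H _ Hx) eps Heps) as [alp [Halp Hc]].
  exists alp; split; [exact Halp|]. intros y [_ Hy].
  simpl in *. unfold Rdist in *.
  destruct (Req_dec (Rmax 0 x) (Rmax 0 y)) as [E|E].
  - rewrite <- E, Rminus_diag, Rabs_R0. exact Heps.
  - apply Hc. split.
    + split; [apply Rmax_l | exact E].
    + eapply Rle_lt_trans; [|exact Hy].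
      unfold Rmax, Rabs in *.
      repeat destruct Rle_dec; repeat destruct Rcase_abs; lra.
Qed.

Lemma Rmax_0_half_line (x : R) : half_line x -> Rmax 0 x = x.
Proof. apply Rmax_right. Qed.

Lemma is_lim_seq_half_line (f df : R -> R) (u : nat -> R) (l : R) :
  (forall x, half_line x -> D_in f df half_line x) ->
  (forall n, half_line (u n)) -> half_line l ->
  is_lim_seq u l -> is_lim_seq (fun n => f (u n)) (f l).
Proof.
  intros H Hu Hl Hlim.
  pose proof (is_lim_seq_continuous _ u l (continuity_freeze f df H l) Hlim) as E.
  cbv beta in E. rewrite (Rmax_0_half_line l Hl) in E.
  eapply is_lim_seq_ext; [|exact E].
  intros n. cbn beta. rewrite Rmax_0_half_line; auto.
Qed.

Lemma mean_value_half_line (f df : R -> R) (x y : R) :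
  (forall z, half_line z -> D_in f df half_line z) ->
  0 <= x -> x < y ->
  exists c, x <= c <= y /\ f y - f x = df c * (y - x).
Proof.
  intros H Hx Hxy.
  destruct (MVT_gen (fun z => f (Rmax 0 z)) x y df) as [c [Hc E]].
  - intros z Hz. rewrite Rmin_left in Hz by lra. rewrite Rmax_right in Hz by lra.
    apply (is_derive_ext_loc f).
    + apply (filter_imp (fun t => 0 < t)); [intros t Ht | apply locally_pos; lra].
      rewrite Rmax_right by lra. reflexivity.
    + apply D_in_half_line_is_derive; [lra|]. apply H. unfold half_line; lra.
  - intros z _. apply (continuity_freeze f df H).
  - rewrite Rmin_left in Hc by lra. rewrite (Rmax_right x y) in Hc by lra.
    rewrite !Rmax_0_half_line in E by (unfold half_line; lra).
    exists c; split; assumption.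
Qed.

Lemma increasing_half_line (f df : R -> R) :
  (forall z, half_line z -> D_in f df half_line z) ->
  (forall z, half_line z -> 0 < df z) ->
  forall x y, 0 <= x -> x < y -> f x < f y.
Proof.
  intros H Hp x y Hx Hxy.
  destruct (mean_value_half_line f df x y H Hx Hxy) as [c [Hc E]].
  assert (0 < df c * (y - x)).
  { apply Rmult_lt_0_compat; [apply Hp; unfold half_line|]; lra. }
  lra.
Qed.

Lemma derivative_sequence_is_derive (f : R -> R) (d : nat -> R -> R) (x : R) :
  derivative_sequence f d -> 0 < x -> is_derive f x (d 1%nat x).
Proof.
  intros [H0 HS] Hx.
  apply D_in_half_line_is_derive; [exact Hx|].
  apply (D_in_half_line_ext (d 0%nat) f (d 1%nat)); auto; try reflexivity.
  - unfold half_line; lra.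
  - apply HS. unfold half_line; lra.
Qed.

Lemma derivative_sequence_D_in (f : R -> R) (d : nat -> R -> R) (x : R) :
  derivative_sequence f d -> half_line x -> D_in f (d 1%nat) half_line x.
Proof.
  intros [H0 HS] Hx. apply (D_in_half_line_ext (d 0%nat) f (d 1%nat)); auto.
Qed.

(** * Smoothness of inverse functions *)

(** Smoothness by coinduction: a class of functions that is stable under
    differentiation consists of smooth functions, so no closed formula for the
    higher derivatives is needed. *)
Lemma smooth_of_stable_class (P : (R -> R) -> Prop) :
  (forall q, P q -> exists q', P q' /\ forall x, half_line x -> D_in q q' half_line x) ->
  forall f, P f -> smooth f.
Proof.
  intros HP f Hf.
  set (next := fun q => epsilon (inhabits f)
    (fun q' => P q' /\ forall x, half_line x -> D_in q q' half_line x)).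
  assert (Hnext : forall q, P q -> P (next q) /\
    forall x, half_line x -> D_in q (next q) half_line x).
  { intros q Hq. apply epsilon_spec. apply HP, Hq. }
  assert (HPn : forall n, P (Nat.iter n next f)).
  { induction n as [|n IH]; simpl; [exact Hf | apply Hnext, IH]. }
  exists (fun n => Nat.iter n next f). split.
  - reflexivity.
  - intros n x Hx. simpl. apply Hnext; auto.
Qed.

(** The functions obtained algebraically from the identity, the derivatives
    [d n] and [/ d 1]. When [d] lists the derivatives of a function [f] with
    inverse [g], every derivative of [g] is [q] composed with [g] for some [q]
    in this class. *)
Inductive jet_rational (d : nat -> R -> R) : (R -> R) -> Prop :=
| jet_const c : jet_rational d (fun _ => c)
| jet_id : jet_rational d (fun x => x)
| jet_deriv n : jet_rational d (d n)
| jet_inv : jet_rational d (fun x => / d 1%nat x)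
| jet_add q r : jet_rational d q -> jet_rational d r -> jet_rational d (fun x => q x + r x)
| jet_mul q r : jet_rational d q -> jet_rational d r -> jet_rational d (fun x => q x * r x).

Lemma D_in_half_line_inv (f df : R -> R) (x : R) :
  f x <> 0 -> D_in f df half_line x ->
  D_in (fun y => / f y) (fun y => -1 * (df y * (/ f y * / f y))) half_line x.
Proof.
  intros Hf H.
  assert (HD : D_in Rinv (fun y => -1 * (/ y * / y)) no_cond (f x)).
  { apply derivable_pt_lim_D_in. apply is_derive_Reals.
    auto_derive; [exact Hf|]. field. exact Hf. }
  apply (D_in_ext (fun y => df y * (-1 * (/ f y * / f y)))); [ring|].
  apply (D_in_imp _ _ (Dgf half_line no_cond f)).
  - intros y Hy; split; [exact Hy | exact I].
  - apply (Dcomp half_line no_cond df _ f Rinv x H HD).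
Qed.

Lemma jet_rational_derivative (d : nat -> R -> R) :
  (forall n x, half_line x -> D_in (d n) (d (S n)) half_line x) ->
  (forall x, half_line x -> d 1%nat x <> 0) ->
  forall q, jet_rational d q ->
  exists q', jet_rational d q' /\ forall x, half_line x -> D_in q q' half_line x.
Proof.
  intros Hd Hnz q Hq.
  induction Hq as [c| |n| |q r Hq [q' [Hq' Dq]] Hr [r' [Hr' Dr]]
                  |q r Hq [q' [Hq' Dq]] Hr [r' [Hr' Dr]]].
  - exists (fun _ => 0). split; [apply jet_const|]. intros; apply Dconst.
  - exists (fun _ => 1). split; [apply jet_const|]. intros; apply Dx.
  - exists (d (S n)). split; [apply jet_deriv | auto].
  - exists (fun x => -1 * (d 2%nat x * (/ d 1%nat x * / d 1%nat x))). split.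
    + apply (jet_mul d (fun _ => -1)); [apply jet_const|].
      apply (jet_mul d (d 2%nat)); [apply jet_deriv|].
      apply (jet_mul d (fun x => / d 1%nat x)); apply jet_inv.
    + intros x Hx. apply D_in_half_line_inv; auto.
  - exists (fun x => q' x + r' x). split; [apply jet_add; assumption|].
    intros x Hx. apply Dadd; auto.
  - exists (fun x => q' x * r x + q x * r' x). split.
    + apply (jet_add d (fun x => q' x * r x)); apply jet_mul; assumption.
    + intros x Hx. apply Dmult; auto.
Qed.

Lemma inverse_continue_in (f df g : R -> R) :
  (forall x, half_line x -> D_in f df half_line x) ->
  (forall x, half_line x -> 0 < df x) ->
  inverse_maps f g ->
  forall y, half_line y -> limit1_in g half_line (g y) y.
Proof.
  intros Hf Hp Hinv y Hy eps Heps.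
  pose proof (increasing_half_line f df Hf Hp) as Hinc.
  destruct (Hinv y Hy) as [_ [Hgy [_ Hfg]]]. unfold half_line in *.
  assert (Hup : y < f (g y + eps)) 
    by (pose proof (Hinc (g y) (g y + eps) Hgy ltac:(lra)); lra).
  (* Below [g y] the half-line may end within distance [eps]; then the lower
     bound is automatic and any positive radius will do. *)
  assert (Hlow : exists e, 0 < e /\ forall z, 0 <= z -> y - e < z -> g y - eps < g z).
  { destruct (Rle_lt_dec 0 (g y - eps)) as [Hc|Hc].
    - exists (y - f (g y - eps)). split.
      + pose proof (Hinc (g y - eps) (g y) Hc ltac:(lra)). lra.
      + intros z Hz Hyz. destruct (Hinv z Hz) as [_ [Hgz [_ Hfgz]]].
        destruct (Rlt_le_dec (g y - eps) (g z)) as [|Hle]; [assumption|exfalso].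
        destruct Hle as [Hlt|Heq].
        * pose proof (Hinc (g z) (g y - eps) Hgz Hlt). lra.
        * rewrite Heq in Hfgz. lra.
    - exists 1. split; [lra|]. intros z Hz _.
      destruct (Hinv z Hz) as [_ [Hgz _]].
      unfold half_line in Hgz. lra. }
  destruct Hlow as [e [He Hlow]].
  exists (Rmin e (f (g y + eps) - y)). split.
  - apply Rlt_gt, Rmin_case; lra.
  - intros z [Hz Hzy]. simpl in *. unfold Rdist in *.
    pose proof (Rmin_l e (f (g y + eps) - y)).
    pose proof (Rmin_r e (f (g y + eps) - y)).
    apply Rabs_def2 in Hzy. destruct (Hinv z Hz) as [_ [Hgz [_ Hfgz]]].
    unfold half_line in Hgz.
    apply Rabs_def1.
    + destruct (Rlt_le_dec (g z) (g y + eps)) as [|Hle]; [lra|exfalso].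
      destruct Hle as [Hlt|Heq].
      * pose proof (Hinc (g y + eps) (g z) ltac:(lra) Hlt). lra.
      * rewrite <- Heq in Hfgz. lra.
    + pose proof (Hlow z Hz ltac:(lra)). lra.
Qed.

Lemma D_in_half_line_inverse (f df g : R -> R) :
  (forall x, half_line x -> D_in f df half_line x) ->
  (forall x, half_line x -> 0 < df x) ->
  inverse_maps f g ->
  forall y, half_line y -> D_in g (fun z => / df (g z)) half_line y.
Proof.
  intros Hf Hp Hinv y Hy.
  pose proof (inverse_continue_in f df g Hf Hp Hinv y Hy) as Hc.
  destruct (Hinv y Hy) as [_ [Hgy [_ Hfg]]].
  pose proof (limit_inv _ _ _ _ (Hf _ Hgy)
                (Rgt_not_eq _ _ (Hp _ Hgy))) as Hq.
  intros eps Heps. destruct (Hq eps Heps) as [alp [Halp Hlim]].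
  destruct (Hc alp Halp) as [bet [Hbet Hclose]].
  exists bet. split; [exact Hbet|]. intros z [[Hz Hyz] Hdist].
  destruct (Hinv z Hz) as [_ [Hgz [_ Hfgz]]].
  assert (Hne : g y <> g z) by (intro E; apply Hyz; rewrite <- Hfg, <- Hfgz, E; reflexivity).
  specialize (Hlim (g z) (conj (conj Hgz Hne) (Hclose z (conj Hz Hdist)))).
  rewrite Hfg, Hfgz in Hlim. simpl in *.
  replace ((g z - g y) / (z - y)) with (/ ((z - y) / (g z - g y))); [exact Hlim|].
  field. split; lra.
Qed.

Lemma smooth_inverse (f g : R -> R) (d : nat -> R -> R) :
  derivative_sequence f d ->
  (forall x, half_line x -> 0 < d 1%nat x) ->
  inverse_maps f g -> smooth g.
Proof.
  intros Hd Hp Hinv.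
  apply (smooth_of_stable_class
           (fun r => exists q, jet_rational d q /\ r = fun y => q (g y))).
  - intros r [q [Hq Er]].
    assert (Hnz : forall x, half_line x -> d 1%nat x <> 0)
      by (intros x Hx; apply Rgt_not_eq, Hp, Hx).
    destruct (jet_rational_derivative d (proj2 Hd) Hnz q Hq) as [q' [Hq' Dq]].
    exists (fun y => / d 1%nat (g y) * q' (g y)). split.
    + exists (fun x => / d 1%nat x * q' x). split; [|reflexivity].
      apply (jet_mul d (fun x => / d 1%nat x)); [apply jet_inv | exact Hq'].
    + intros y Hy. rewrite Er.
      apply (D_in_half_line_comp g q (fun z => / d 1%nat (g z)) q').
      * intros z Hz. apply Hinv, Hz.
      * exact Hy.
      * apply (D_in_half_line_inverse f); auto.
        intros x Hx. apply derivative_sequence_D_in; assumption.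
      * apply Dq. apply Hinv, Hy.
  - exists (fun x => x). split; [apply jet_id | reflexivity].
Qed.

(** * Diffeomorphisms of the half-line *)

Lemma nonvanishing_sign (f df : R -> R) :
  (forall x, half_line x -> D_in f df half_line x) ->
  (forall x, half_line x -> f x <> 0) ->
  (forall x, half_line x -> 0 < f x) \/ (forall x, half_line x -> f x < 0).
Proof.
  intros H Hnz.
  assert (Hs : forall x, half_line x -> 0 < f 0 * f x).
  { intros x Hx. apply Rnot_le_lt. intros Hle.
    destruct (IVT_gen (fun z => f (Rmax 0 z)) 0 x 0) as [z [Hz Ez]].
    - apply (continuity_freeze f df H).
    - rewrite !Rmax_0_half_line by (assumption || (unfold half_line; lra)).
      unfold Rmin, Rmax. destruct Rle_dec; nra.
    - apply (Hnz (Rmax 0 z)); [apply Rmax_l | exact Ez]. }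
  assert (H0 : f 0 <> 0) by (apply Hnz; unfold half_line; lra).
  destruct (Rdichotomy _ _ H0) as [Hn|Hp]; [right|left];
    intros x Hx; specialize (Hs x Hx); nra.
Qed.

Lemma diffeo_increasing_data (f finv : R -> R) :
  diffeo_with_inverse f finv ->
  exists d, derivative_sequence f d /\
    (forall x, half_line x -> 0 < d 1%nat x) /\ f 0 = 0.
Proof.
  intros [Hinv [[d Hd] [e He]]].
  exists d. split; [exact Hd|].
  assert (Df : forall x, half_line x -> D_in f (d 1%nat) half_line x)
    by (intros; apply derivative_sequence_D_in; assumption).
  assert (H0 : half_line 0) by (unfold half_line; lra).
  assert (Hnz : forall x, half_line x -> d 1%nat x <> 0).
  { intros x Hx E.
    assert (E1 : d 1%nat x * e 1%nat (f x) = 1).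
    { apply (D_in_half_line_unique (fun y => finv (f y))
               (fun y => d 1%nat y * e 1%nat (f y)) (fun _ => 1) x Hx).
      - apply (D_in_half_line_comp f finv); auto.
        + intros y Hy. apply Hinv, Hy.
        + apply derivative_sequence_D_in; [exact He|]. apply Hinv, Hx.
      - apply (D_in_half_line_ext (fun y => y) _ (fun _ => 1)); auto.
        + intros y Hy. symmetry. apply Hinv, Hy.
        + apply Dx. }
    rewrite E, Rmult_0_l in E1. lra. }
  destruct (nonvanishing_sign (d 1%nat) (d 2%nat) (proj2 Hd 1%nat) Hnz) as [Hp|Hn].
  - split; [exact Hp|].
    destruct (Hinv 0 H0) as [Hf0 [Hz [_ Efz]]]. unfold half_line in *.
    destruct Hz as [Hz|Hz].
    + pose proof (increasing_half_line f _ Df Hp 0 (finv 0) ltac:(lra) Hz). lra.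
    + rewrite <- Hz in Efz. exact Efz.
  - (* A decreasing map would stay below [f 0] and could not be onto. *)
    exfalso.
    assert (Hdec : forall x, 0 < x -> f x < f 0).
    { intros x Hx.
      enough (- f 0 < - f x) by lra.
      apply (increasing_half_line (fun y => - f y) (fun y => - d 1%nat y)); try lra.
      - intros z Hz. apply Dopp, Df, Hz.
      - intros z Hz. specialize (Hn z Hz). lra. }
    destruct (Hinv 0 H0) as [Hf0 _].
    assert (Hf1 : half_line (f 0 + 1)) by (unfold half_line in *; lra).
    destruct (Hinv _ Hf1) as [_ [Hz [_ Efz]]].
    destruct Hz as [Hz|Hz].
    + specialize (Hdec _ Hz). lra.
    + rewrite <- Hz in Efz. lra.
Qed.

Lemma unbounded_diffeo (f : R -> R) (d : nat -> R -> R) :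
  derivative_sequence f d ->
  (forall x, half_line x -> 0 < d 1%nat x) -> f 0 = 0 ->
  (forall M, exists x, 0 < x /\ M < f x) ->
  exists finv, diffeo_with_inverse f finv.
Proof.
  intros Hd Hp H0 Hunb.
  assert (Df : forall x, half_line x -> D_in f (d 1%nat) half_line x)
    by (intros; apply derivative_sequence_D_in; assumption).
  pose proof (increasing_half_line f _ Df Hp) as Hinc.
  assert (Hpos : forall x, half_line x -> half_line (f x)).
  { intros x [Hx|Hx]; unfold half_line.
    - pose proof (Hinc 0 x (Rle_refl 0) Hx). lra.
    - rewrite <- Hx, H0. lra. }
  assert (Hsurj : forall y, half_line y -> exists x, half_line x /\ f x = y).
  { intros y Hy. destruct (Hunb y) as [b [Hb Hyb]].
    destruct (IVT_gen (fun z => f (Rmax 0 z)) 0 b y) as [z [Hz Ez]].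
    - apply (continuity_freeze f _ Df).
    - rewrite !Rmax_0_half_line by (unfold half_line; lra).
      rewrite H0. unfold half_line in *.
      rewrite Rmin_left, Rmax_right by lra. lra.
    - exists (Rmax 0 z). split; [apply Rmax_l | exact Ez]. }
  assert (Hinj : forall x y, half_line x -> half_line y -> f x = f y -> x = y).
  { intros x y Hx Hy E. unfold half_line in *.
    destruct (Rtotal_order x y) as [H|[H|H]]; [|exact H|].
    - pose proof (Hinc x y Hx H). lra.
    - pose proof (Hinc y x Hy H). lra. }
  set (g := fun y => epsilon (inhabits 0) (fun x => half_line x /\ f x = y)).
  assert (Hg : forall y, half_line y -> half_line (g y) /\ f (g y) = y)
    by (intros y Hy; apply epsilon_spec, Hsurj, Hy).
  assert (Hinv : inverse_maps f g).
  { intros x Hx. destruct (Hg x Hx) as [Hgx Efg].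
    destruct (Hg (f x) (Hpos x Hx)) as [Hgf Efgf]. auto. }
  exists g. split; [exact Hinv|]. split.
  - exists d. exact Hd.
  - apply (smooth_inverse f g d); assumption.
Qed.

(** * Orbits and their derivative products *)

Lemma S_minus_data (f : R -> R) :
  S_minus f ->
  exists d, derivative_sequence f d /\
    (forall x, half_line x -> 0 < d 1%nat x) /\ f 0 = 0 /\
    (forall x y, 0 <= x -> x < y -> f x < f y).
Proof.
  intros [[finv Hf] _].
  destruct (diffeo_increasing_data f finv Hf) as [d [Hd [Hp H0]]].
  exists d. repeat split; try assumption; try apply Hd.
  apply (increasing_half_line f (d 1%nat)); [|exact Hp].
  intros; apply derivative_sequence_D_in; assumption.
Qed.

Lemma S_minus_pos (f : R -> R) (x : R) : S_minus f -> 0 < x -> 0 < f x.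
Proof.
  intros Hf Hx. destruct (S_minus_data f Hf) as [d [_ [_ [H0 Hinc]]]].
  rewrite <- H0. apply Hinc; lra.
Qed.

Lemma S_minus_is_derive (f : R -> R) (x : R) :
  S_minus f -> 0 < x -> is_derive f x (Derive f x).
Proof.
  intros Hf Hx. destruct (S_minus_data f Hf) as [d [Hd _]].
  apply Derive_correct. exists (d 1%nat x).
  apply derivative_sequence_is_derive; assumption.
Qed.

Lemma S_minus_Derive_pos (f : R -> R) (x : R) :
  S_minus f -> 0 < x -> 0 < Derive f x.
Proof.
  intros Hf Hx. destruct (S_minus_data f Hf) as [d [Hd [Hp _]]].
  rewrite (is_derive_unique f x (d 1%nat x)).
  - apply Hp. unfold half_line; lra.
  - apply derivative_sequence_is_derive; assumption.
Qed.

Lemma orbit_pos (f : R -> R) (x : R) (n : nat) :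
  S_minus f -> 0 < x -> 0 < Nat.iter n f x.
Proof.
  intros Hf Hx. induction n as [|n IH]; simpl; [exact Hx|].
  apply S_minus_pos; assumption.
Qed.

Lemma orbit_monotone (f : R -> R) (x y : R) (n : nat) :
  S_minus f -> 0 < x -> x <= y -> Nat.iter n f x <= Nat.iter n f y.
Proof.
  intros Hf Hx Hxy. induction n as [|n IH]; simpl; [exact Hxy|].
  destruct (S_minus_data f Hf) as [d [_ [_ [_ Hinc]]]].
  destruct IH as [IH|IH].
  - left. apply Hinc; [|exact IH]. left. apply orbit_pos; assumption.
  - rewrite IH. lra.
Qed.

Lemma orbit_decreasing (f : R -> R) (x : R) (n k : nat) :
  S_minus f -> 0 < x -> Nat.iter (k + n) f x <= Nat.iter n f x.
Proof.
  intros Hf Hx. induction k as [|k IH]; simpl; [lra|].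
  pose proof (proj2 Hf _ (orbit_pos f x (k + n) Hf Hx)). simpl in *. lra.
Qed.

(** A positive limit of the orbit would be a fixed point of [f]. *)
Lemma orbit_tends_to_0 (f : R -> R) (x : R) :
  S_minus f -> 0 < x -> is_lim_seq (fun n => Nat.iter n f x) 0.
Proof.
  intros Hf Hx.
  assert (Hpos : forall n, 0 < Nat.iter n f x) by (intros; apply orbit_pos; assumption).
  assert (Hdec : forall n, Nat.iter (S n) f x <= Nat.iter n f x)
    by (intros n; apply (orbit_decreasing f x n 1 Hf Hx)).
  destruct (ex_finite_lim_seq_decr (fun n => Nat.iter n f x) 0 Hdec) as [l Hl].
  { intros n. left. apply Hpos. }
  assert (Hl0 : 0 <= l).
  { apply (is_lim_seq_le (fun _ => 0) (fun n => Nat.iter n f x) 0 l).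
    - intros n; left; apply Hpos.
    - apply is_lim_seq_const.
    - exact Hl. }
  destruct Hl0 as [Hl0|Hl0]; [exfalso|rewrite Hl0; exact Hl].
  destruct (S_minus_data f Hf) as [d [Hd _]].
  assert (Hfl : is_lim_seq (fun n => Nat.iter (S n) f x) (f l)).
  { apply (is_lim_seq_half_line f (d 1%nat)); try (unfold half_line; lra).
    - intros; apply derivative_sequence_D_in; assumption.
    - intros n; left; apply Hpos.
    - exact Hl. }
  apply (is_lim_seq_incr_1 (fun n => Nat.iter n f x)) in Hl.
  apply is_lim_seq_unique in Hl. apply is_lim_seq_unique in Hfl.
  rewrite Hl in Hfl. injection Hfl as E.
  pose proof (proj2 Hf l Hl0). lra.
Qed.

Lemma orbit_eventually_below (f : R -> R) (x e : R) :
  S_minus f -> 0 < x -> 0 < e -> exists n, Nat.iter n f x < e.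
Proof.
  intros Hf Hx He.
  destruct (proj1 (is_lim_seq_Reals _ _) (orbit_tends_to_0 f x Hf Hx) e He) as [n Hn].
  exists n. specialize (Hn n (le_n n)). unfold Rdist in Hn.
  apply Rabs_def2 in Hn. lra.
Qed.

(** * Convergence of the products *)

Lemma H1_partial_pos (f g : R -> R) (x y : R) (N : nat) :
  S_minus f -> S_minus g -> 0 < x -> 0 < y -> 0 < H1_partial f g x y N.
Proof.
  intros Hf Hg Hx Hy. unfold H1_partial.
  induction N as [|N IH]; cbn [prod_f_R0].
  - apply Rdiv_lt_0_compat; apply S_minus_Derive_pos; assumption.
  - apply Rmult_lt_0_compat; [exact IH|].
    apply Rdiv_lt_0_compat; apply S_minus_Derive_pos; try assumption;
      apply orbit_pos; assumption.
Qed.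

Lemma log_Derive_lipschitz (f : R -> R) (X : R) :
  S_minus f -> 0 < X ->
  exists C, 0 <= C /\ forall x y, 0 < x <= X -> 0 < y <= X ->
    Rabs (ln (Derive f x) - ln (Derive f y)) <= C * Rabs (x - y).
Proof.
  intros Hf HX. destruct (S_minus_data f Hf) as [d [Hd [Hp _]]].
  set (q := fun x => d 2%nat x * / d 1%nat x).
  assert (Hq : continuity (fun x => Rabs (q (Rmax 0 x)))).
  { intros x. apply (continuity_pt_comp (fun x => q (Rmax 0 x)) Rabs);
      [|apply Rcontinuity_abs].
    apply (continuity_pt_mult (fun x => d 2%nat (Rmax 0 x)) (fun x => / d 1%nat (Rmax 0 x))).
    - apply (continuity_freeze (d 2%nat) (d 3%nat)). apply (proj2 Hd).
    - apply (continuity_pt_inv (fun x => d 1%nat (Rmax 0 x))).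
      + apply (continuity_freeze (d 1%nat) (d 2%nat)). apply (proj2 Hd).
      + apply Rgt_not_eq, Hp, Rmax_l. }
  destruct (continuity_ab_maj _ 0 X (Rlt_le _ _ HX) (fun c _ => Hq c)) as [M [HM _]].
  exists (Rabs (q (Rmax 0 M))). split; [apply Rabs_pos|].
  intros x y Hx Hy.
  assert (Hder : forall z, 0 < z -> is_derive (fun t => ln (Derive f t)) z (q z)).
  { intros z Hz.
    apply (is_derive_ext_loc (fun t => ln (d 1%nat t))).
    - apply (filter_imp (fun t => 0 < t)); [intros t Ht | apply locally_pos; lra].
      rewrite (is_derive_unique f t (d 1%nat t)); [reflexivity|].
      apply derivative_sequence_is_derive; [exact Hd | lra].
    - apply (is_derive_comp ln (d 1%nat) z (/ d 1%nat z) (d 2%nat z)).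
      + apply is_derive_ln. apply Hp. unfold half_line; lra.
      + apply D_in_half_line_is_derive; [exact Hz|].
        apply (proj2 Hd). unfold half_line; lra. }
  assert (Hmin : 0 < Rmin y x) by (apply Rmin_case; lra).
  assert (Hmax : Rmax y x <= X) by (apply Rmax_case; lra).
  destruct (MVT_gen (fun t => ln (Derive f t)) y x q) as [c [Hc E]].
  - intros z Hz. apply Hder. lra.
  - intros z Hz. apply continuity_pt_filterlim.
    apply (ex_derive_continuous (fun t => ln (Derive f t))).
    exists (q z). apply Hder. lra.
  - rewrite E, Rabs_mult. apply Rmult_le_compat_r; [apply Rabs_pos|].
    specialize (HM c ltac:(lra)). rewrite Rmax_0_half_line in HM by (unfold half_line; lra).
    exact HM.
Qed.

(** Both [s - w] and [s + w] are monotone, and they are adjacent. *)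
Lemma telescoping_bound_converges (s w : nat -> R) :
  is_lim_seq w 0 ->
  (forall n, Rabs (s (S n) - s n) <= w n - w (S n)) ->
  exists l : R, is_lim_seq s l /\ forall n, Rabs (s n - l) <= w n.
Proof.
  intros Hw H.
  assert (Hu : forall n, s n - w n <= s (S n) - w (S n)).
  { intros n. specialize (H n). apply Rabs_le_between in H. lra. }
  assert (Hv : forall n, s (S n) + w (S n) <= s n + w n).
  { intros n. specialize (H n). apply Rabs_le_between in H. lra. }
  destruct (ex_lim_seq_adj _ _ Hu Hv) as [[l Hl] _].
  { apply (is_lim_seq_ext (fun n => 2 * w n)); [intros; ring|].
    replace (Finite 0) with (Rbar_mult 2 0) by (simpl; f_equal; ring).
    apply is_lim_seq_scal_l, Hw. }
  assert (Hs : is_lim_seq s l).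
  { apply (is_lim_seq_ext (fun n => (s n - w n) + w n)); [intros; ring|].
    replace l with (l + 0) by ring. apply is_lim_seq_plus'; assumption. }
  assert (Hl' : is_lim_seq (fun n => s n + w n) l).
  { replace l with (l + 0) by ring. apply is_lim_seq_plus'; assumption. }
  exists l. split; [exact Hs|]. intros n.
  pose proof (is_lim_seq_incr_compare _ _ Hl Hu n).
  pose proof (is_lim_seq_decr_compare _ _ Hl' Hv n).
  cbn beta in *. apply Rabs_le_between. lra.
Qed.

Lemma window_sum_shift (v : nat -> R) (k n : nat) :
  sum_f_R0 (fun j => v (j + n)%nat) k - sum_f_R0 (fun j => v (j + S n)%nat) k
  = v n - v (S k + n)%nat.
Proof.
  induction k as [|k IH]; cbn [sum_f_R0].
  - reflexivity.
  - rewrite <- (plus_n_Sm (S k) n).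
    transitivity (sum_f_R0 (fun j => v (j + n)%nat) k
      - sum_f_R0 (fun j => v (j + S n)%nat) k + v (S k + n)%nat - v (S (S k + n))).
    + ring.
    + rewrite IH. simpl. ring.
Qed.

Lemma window_sum_tends_to_0 (v : nat -> R) (k : nat) :
  is_lim_seq v 0 -> is_lim_seq (fun n => sum_f_R0 (fun j => v (j + n)%nat) k) 0.
Proof.
  intros Hv. induction k as [|k IH]; cbn [sum_f_R0].
  - exact Hv.
  - replace 0 with (0 + 0) by ring. apply is_lim_seq_plus'; [exact IH|].
    apply (is_lim_seq_ext (fun n => v (n + S k)%nat)).
    + intros n. rewrite Nat.add_comm. reflexivity.
    + apply is_lim_seq_incr_n. exact Hv.
Qed.

(** Bounded distortion. If [f^k X <= m], then for [x] and [y] between [m] and [X] the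
    points [f^n x] and [f^n y] both lie between [f^(n+k) X] and [f^n X], and the
    sum of the lengths of these intervals telescopes. Hence the logarithms of
    the products form a Cauchy sequence, with a rate that depends only on [m]
    and [X]. *)
Lemma bounded_distortion (f : R -> R) (m X : R) :
  S_minus f -> 0 < m -> m <= X ->
  exists w, is_lim_seq w 0 /\
    forall x y, m <= x <= X -> m <= y <= X -> forall n,
      Rabs (ln (H1_partial f f x y (S n)) - ln (H1_partial f f x y n))
      <= w n - w (S n).
Proof.
  intros Hf Hm HmX.
  destruct (log_Derive_lipschitz f X Hf ltac:(lra)) as [C [HC Hlip]].
  destruct (orbit_eventually_below f X m Hf ltac:(lra) Hm) as [k Hk].
  set (v := fun n => Nat.iter (S n) f X).
  exists (fun n => C * sum_f_R0 (fun j => v (j + n)%nat) k). split.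
  - replace (Finite 0) with (Rbar_mult C 0) by (simpl; f_equal; ring).
    apply is_lim_seq_scal_l, window_sum_tends_to_0.
    apply -> (is_lim_seq_incr_1 (fun n => Nat.iter n f X)).
    apply orbit_tends_to_0; [exact Hf | lra].
  - intros x y Hx Hy n.
    rewrite <- Rmult_minus_distr_l, window_sum_shift.
    assert (Hrange : forall z, m <= z <= X ->
      v (S k + n)%nat <= Nat.iter (S n) f z <= v n).
    { intros z Hz. split.
      - apply Rle_trans with (Nat.iter (S n) f (Nat.iter (S k) f X)).
        + unfold v. rewrite <- Nat.iter_add. right. f_equal. lia.
        + apply orbit_monotone; [exact Hf | apply orbit_pos; [exact Hf | lra] |].
          pose proof (orbit_decreasing f X k 1 Hf ltac:(lra)). simpl in *. lra.
      - apply orbit_monotone; [exact Hf | lra | lra]. }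
    assert (Htop : v n <= X).
    { pose proof (orbit_decreasing f X 0 (S n) Hf ltac:(lra)) as E.
      rewrite Nat.add_0_r in E. exact E. }
    assert (Hxn : 0 < Nat.iter (S n) f x) by (apply orbit_pos; [exact Hf | lra]).
    assert (Hyn : 0 < Nat.iter (S n) f y) by (apply orbit_pos; [exact Hf | lra]).
    pose proof (Hrange x Hx) as Rx. pose proof (Hrange y Hy) as Ry.
    assert (Hpx := S_minus_Derive_pos f _ Hf Hxn).
    assert (Hpy := S_minus_Derive_pos f _ Hf Hyn).
    replace (ln (H1_partial f f x y (S n)) - ln (H1_partial f f x y n))
      with (ln (Derive f (Nat.iter (S n) f x)) - ln (Derive f (Nat.iter (S n) f y))).
    + eapply Rle_trans.
      * apply Hlip; lra.
      * apply Rmult_le_compat_l; [exact HC|]. apply Rabs_le_between. lra.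
    + unfold H1_partial at 1. cbn [prod_f_R0]. fold (H1_partial f f x y n).
      rewrite ln_mult, ln_div; try assumption; [ring| |].
      * apply H1_partial_pos; try assumption; lra.
      * apply Rdiv_lt_0_compat; assumption.
Qed.

(** The limit is described through its logarithm since this is where the rate
    of convergence is uniform. *)
Lemma self_product_uniform_limit (f : R -> R) (m X : R) :
  S_minus f -> 0 < m -> m <= X ->
  exists w, is_lim_seq w 0 /\
    forall x y, m <= x <= X -> m <= y <= X ->
      0 < H1 f f x y /\ is_lim_seq (H1_partial f f x y) (H1 f f x y) /\
      forall n, Rabs (ln (H1_partial f f x y n) - ln (H1 f f x y)) <= w n.
Proof.
  intros Hf Hm HmX.
  destruct (bounded_distortion f m X Hf Hm HmX) as [w [Hw Hdist]].
  exists w. split; [exact Hw|]. intros x y Hx Hy.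
  destruct (telescoping_bound_converges _ w Hw (Hdist x y Hx Hy)) as [l [Hl Hrate]].
  assert (Hlim : is_lim_seq (H1_partial f f x y) (exp l)).
  { apply (is_lim_seq_ext (fun n => exp (ln (H1_partial f f x y n)))).
    - intros n. apply exp_ln, H1_partial_pos; try assumption; lra.
    - apply is_lim_seq_continuous; [|exact Hl].
      apply derivable_continuous_pt, derivable_pt_exp. }
  assert (E : H1 f f x y = exp l).
  { unfold H1. rewrite (is_lim_seq_unique _ _ Hlim). reflexivity. }
  rewrite E, ln_exp. split; [apply exp_pos|]. split; [exact Hlim | exact Hrate].
Qed.

Lemma self_product_limit (f : R -> R) (x y : R) :
  S_minus f -> 0 < x -> 0 < y ->
  0 < H1 f f x y /\ is_lim_seq (H1_partial f f x y) (H1 f f x y).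
Proof.
  intros Hf Hx Hy.
  pose proof (Rmin_l x y). pose proof (Rmin_r x y).
  pose proof (Rmax_l x y). pose proof (Rmax_r x y).
  destruct (self_product_uniform_limit f (Rmin x y) (Rmax x y) Hf) as [w [_ Hw]].
  - apply Rmin_case; assumption.
  - lra.
  - destruct (Hw x y) as [Hpos [Hlim _]]; try lra. auto.
Qed.

Lemma Derive_continuity_pt (f : R -> R) (x : R) :
  S_minus f -> 0 < x -> continuity_pt (Derive f) x.
Proof.
  intros Hf Hx. destruct (S_minus_data f Hf) as [d [Hd _]].
  apply (continuity_pt_ext_loc (d 1%nat)).
  - apply (filter_imp (fun t => 0 < t)); [intros t Ht | apply locally_pos; lra].
    symmetry. apply is_derive_unique.
    apply derivative_sequence_is_derive; [exact Hd | lra].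
  - apply continuity_pt_filterlim, (ex_derive_continuous (d 1%nat)).
    exists (d 2%nat x). apply D_in_half_line_is_derive; [exact Hx|].
    apply (proj2 Hd). unfold half_line; lra.
Qed.

Lemma orbit_continuity_pt (f : R -> R) (n : nat) (x : R) :
  S_minus f -> 0 < x -> continuity_pt (fun t => Nat.iter n f t) x.
Proof.
  intros Hf Hx. induction n as [|n IH]; simpl.
  - apply continuity_pt_id.
  - apply (continuity_pt_comp (fun t => Nat.iter n f t) f); [exact IH|].
    apply continuity_pt_filterlim, (ex_derive_continuous f).
    eexists. apply S_minus_is_derive; [exact Hf|]. apply orbit_pos; assumption.
Qed.

Lemma H1_partial_continuity_pt (f : R -> R) (y : R) (N : nat) (x : R) :
  S_minus f -> 0 < x -> continuity_pt (fun t => H1_partial f f t y N) x.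
Proof.
  intros Hf Hx.
  assert (Hterm : forall n, continuity_pt
    (fun t => Derive f (Nat.iter n f t) / Derive f (Nat.iter n f y)) x).
  { intros n.
    apply (continuity_pt_mult (fun t => Derive f (Nat.iter n f t))
             (fun _ => / Derive f (Nat.iter n f y))).
    - apply (continuity_pt_comp (fun t => Nat.iter n f t) (Derive f)).
      + apply orbit_continuity_pt; assumption.
      + apply Derive_continuity_pt; [exact Hf|]. apply orbit_pos; assumption.
    - apply continuity_pt_const. intros ? ?. reflexivity. }
  unfold H1_partial. induction N as [|N IH]; cbn [prod_f_R0].
  - apply (Hterm 0%nat).
  - apply (continuity_pt_mult
      (fun t => prod_f_R0 (fun n => Derive f (Nat.iter n f t) / Derive f (Nat.iter n f y)) N)).
    + exact IH.
    + apply (Hterm (S N)).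
Qed.

Lemma self_product_continuous (f : R -> R) (y x : R) :
  S_minus f -> 0 < y -> 0 < x -> continuous (fun t => H1 f f t y) x.
Proof.
  intros Hf Hy Hx.
  assert (Hr : 0 < x / 2) by lra. set (r := mkposreal _ Hr).
  set (m := Rmin y (x / 2)). set (X := Rmax y (x + x / 2)).
  assert (Hm : 0 < m) by (apply Rmin_case; lra).
  assert (HyX : m <= y <= X) by (split; [apply Rmin_l | apply Rmax_l]).
  assert (HtX : forall t, Boule x r t -> m <= t <= X).
  { intros t Ht. unfold Boule in Ht. simpl in Ht. apply Rabs_def2 in Ht.
    pose proof (Rmin_r y (x / 2)). pose proof (Rmax_r y (x + x / 2)).
    fold m in H. fold X in H0. lra. }
  destruct (self_product_uniform_limit f m X Hf Hm ltac:(lra)) as [w [Hw Hlim]].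
  assert (Hln : continuity_pt (fun t => ln (H1 f f t y)) x).
  { apply (CVU_continuity (fun n t => ln (H1_partial f f t y n)) _ x r).
    - intros eps Heps.
      destruct (proj1 (is_lim_seq_Reals _ _) Hw eps Heps) as [N HN].
      exists N. intros n t Hn Ht.
      destruct (Hlim t y (HtX t Ht) HyX) as [_ [_ Hrate]].
      specialize (Hrate n). specialize (HN n Hn). unfold Rdist in HN.
      rewrite Rabs_minus_sym. rewrite Rminus_0_r in HN.
      apply Rle_lt_trans with (1 := Hrate). apply Rabs_def2 in HN. lra.
    - intros n t Ht. pose proof (HtX t Ht).
      apply (continuity_pt_comp (fun t => H1_partial f f t y n) ln).
      + apply H1_partial_continuity_pt; [exact Hf | lra].
      + apply derivable_continuous_pt. eexists. apply derivable_pt_lim_ln.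
        apply H1_partial_pos; try assumption; lra.
    - unfold Boule. rewrite Rminus_diag, Rabs_R0. apply cond_pos. }
  apply continuity_pt_filterlim.
  apply (continuity_pt_ext_loc (fun t => exp (ln (H1 f f t y)))).
  - exists r. intros t Ht. apply exp_ln.
    destruct (Hlim t y (HtX t Ht) HyX) as [Hpos _]. exact Hpos.
  - apply (continuity_pt_comp (fun t => ln (H1 f f t y)) exp); [exact Hln|].
    apply derivable_continuous_pt, derivable_pt_exp.
Qed.

Lemma H1_partial_cocycle (f g h : R -> R) (x y z : R) (N : nat) :
  S_minus f -> S_minus g -> S_minus h -> 0 < x -> 0 < y -> 0 < z ->
  H1_partial f g x y N * H1_partial g h y z N = H1_partial f h x z N.
Proof.
  intros Hf Hg Hh Hx Hy Hz.
  assert (Hterm : forall n,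
    Derive f (Nat.iter n f x) / Derive g (Nat.iter n g y)
      * (Derive g (Nat.iter n g y) / Derive h (Nat.iter n h z))
    = Derive f (Nat.iter n f x) / Derive h (Nat.iter n h z)).
  { intros n.
    pose proof (S_minus_Derive_pos g _ Hg (orbit_pos g y n Hg Hy)).
    pose proof (S_minus_Derive_pos h _ Hh (orbit_pos h z n Hh Hz)).
    field. lra. }
  unfold H1_partial. induction N as [|N IH]; cbn [prod_f_R0].
  - apply (Hterm 0%nat).
  - rewrite <- IH, <- (Hterm (S N)). ring.
Qed.

(** Condition (P) at one pair of base points propagates to all pairs: the
    cocycle rule changes base points at the cost of convergent products of a
    single map. *)
Lemma H1_limit (f g : R -> R) (x xi : R) :
  S_minus f -> S_minus g -> condition_P f g -> 0 < x -> 0 < xi ->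
  0 < H1 f g x xi /\ is_lim_seq (H1_partial f g x xi) (H1 f g x xi).
Proof.
  intros Hf Hg [x0 [xi0 [Hx0 [Hxi0 [l [Hl Hlim]]]]]] Hx Hxi.
  assert (Hl0 : 0 <= l).
  { apply (is_lim_seq_le (fun _ => 0) (H1_partial f g x0 xi0) 0 l).
    - intros n. left. apply H1_partial_pos; assumption.
    - apply is_lim_seq_const.
    - exact Hlim. }
  destruct (self_product_limit f x x0 Hf Hx Hx0) as [Hp1 Hl1].
  destruct (self_product_limit g xi0 xi Hg Hxi0 Hxi) as [Hp2 Hl2].
  assert (Hlim' : is_lim_seq (H1_partial f g x xi) (H1 f f x x0 * l * H1 g g xi0 xi)).
  { eapply is_lim_seq_ext;
      [|apply is_lim_seq_mult'; [apply is_lim_seq_mult'; [exact Hl1|exact Hlim]|exact Hl2]].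
    intros n. cbn beta. rewrite !H1_partial_cocycle; auto. }
  unfold H1. rewrite (is_lim_seq_unique _ _ Hlim'). simpl.
  split; [|exact Hlim'].
  repeat apply Rmult_lt_0_compat; lra.
Qed.

(** The differential equation is separable. *)
Lemma H1_separated (f g : R -> R) (x xi y : R) :
  S_minus f -> S_minus g -> condition_P f g -> 0 < x -> 0 < xi -> 0 < y ->
  H1 g g xi y * H1 f g x xi = H1 f g x y.
Proof.
  intros Hf Hg HP Hx Hxi Hy.
  destruct (self_product_limit g xi y Hg Hxi Hy) as [_ L1].
  destruct (H1_limit f g x xi Hf Hg HP Hx Hxi) as [_ L2].
  destruct (H1_limit f g x y Hf Hg HP Hx Hy) as [_ L3].
  pose proof (is_lim_seq_mult' _ _ _ _ L2 L1) as L4.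
  apply (is_lim_seq_ext _ (H1_partial f g x y)) in L4.
  - apply is_lim_seq_unique in L3. apply is_lim_seq_unique in L4.
    rewrite L4 in L3. injection L3 as E. lra.
  - intros n. apply H1_partial_cocycle; assumption.
Qed.

Lemma H1_partial_shift (f g : R -> R) (x xi : R) (N : nat) :
  H1_partial f g (f x) (g xi) N * (Derive f x / Derive g xi)
  = H1_partial f g x xi (S N).
Proof.
  unfold H1_partial. induction N as [|N IH]; cbn [prod_f_R0].
  - simpl. ring.
  - cbn [prod_f_R0] in IH. rewrite <- IH.
    rewrite !(Nat.iter_swap (S N)). simpl. ring.
Qed.

Lemma H1_shift (f g : R -> R) (x xi : R) :
  S_minus f -> S_minus g -> condition_P f g -> 0 < x -> 0 < xi ->
  H1 f g (f x) (g xi) * (Derive f x / Derive g xi) = H1 f g x xi.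
Proof.
  intros Hf Hg HP Hx Hxi.
  destruct (H1_limit f g (f x) (g xi) Hf Hg HP) as [_ L1];
    try (apply S_minus_pos; assumption).
  destruct (H1_limit f g x xi Hf Hg HP Hx Hxi) as [_ L2].
  apply (is_lim_seq_incr_1 (H1_partial f g x xi)) in L2.
  pose proof (is_lim_seq_mult' _ _ _ _ L1
    (is_lim_seq_const (Derive f x / Derive g xi))) as L3.
  apply (is_lim_seq_ext _ (fun n => H1_partial f g x xi (S n))) in L3.
  - apply is_lim_seq_unique in L2. apply is_lim_seq_unique in L3.
    rewrite L3 in L2. injection L2 as E. exact E.
  - intros n. apply H1_partial_shift.
Qed.

(** Along the orbits the infinite product loses its first factors, so it
    tends to 1 like the tail of any convergent product. *)
Lemma H1_along_orbits (f g : R -> R) (x xi : R) :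
  S_minus f -> S_minus g -> condition_P f g -> 0 < x -> 0 < xi ->
  is_lim_seq (fun n => H1 f g (Nat.iter n f x) (Nat.iter n g xi)) 1.
Proof.
  intros Hf Hg HP Hx Hxi.
  destruct (H1_limit f g x xi Hf Hg HP Hx Hxi) as [Hpos L].
  assert (E : forall n, H1 f g (Nat.iter (S n) f x) (Nat.iter (S n) g xi)
                        * H1_partial f g x xi n = H1 f g x xi).
  { induction n as [|n IH].
    - apply H1_shift; assumption.
    - rewrite <- IH.
      rewrite <- (H1_shift f g (Nat.iter (S n) f x) (Nat.iter (S n) g xi) Hf Hg HP
                   (orbit_pos f x (S n) Hf Hx) (orbit_pos g xi (S n) Hg Hxi)).
      unfold H1_partial. cbn [prod_f_R0]. simpl. ring. }
  apply is_lim_seq_incr_1.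
  apply (is_lim_seq_ext (fun n => H1 f g x xi / H1_partial f g x xi n)).
  - intros n. rewrite <- (E n). field.
    apply Rgt_not_eq, H1_partial_pos; assumption.
  - replace 1 with (H1 f g x xi / H1 f g x xi) by (field; lra).
    apply is_lim_seq_div'; [apply is_lim_seq_const | exact L | lra].
Qed.

(** * Uniqueness for the separable equation *)

Lemma antiderivative_open_half_line (G : R -> R) :
  (forall x, 0 < x -> continuous G x) ->
  exists B, forall x, 0 < x -> is_derive B x (G x).
Proof.
  intros HG. exists (RInt G 1). intros x Hx.
  apply (is_derive_RInt G (RInt G 1) 1 x); [|apply HG, Hx].
  apply (filter_imp (fun t => 0 < t)); [intros t Ht | apply locally_pos; lra].
  apply (RInt_correct G), (ex_RInt_continuous G). intros z Hz. apply HG.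
  assert (0 < Rmin 1 t) by (apply Rmin_case; lra). lra.
Qed.

Lemma mean_value_open_half_line (F dF : R -> R) (x y : R) :
  (forall z, 0 < z -> is_derive F z (dF z)) -> 0 < x -> 0 < y ->
  exists c, 0 < c /\ F y - F x = dF c * (y - x).
Proof.
  intros H Hx Hy.
  assert (Hmin : 0 < Rmin x y) by (apply Rmin_case; lra).
  destruct (MVT_gen F x y dF) as [c [Hc E]].
  - intros z Hz. apply H. lra.
  - intros z Hz. apply continuity_pt_filterlim, (ex_derive_continuous F).
    exists (dF z). apply H. lra.
  - exists c. split; [lra | exact E].
Qed.

(** If [B] is an antiderivative of [G], then [B] composed with a solution of
    [G (psi) psi' = K] has derivative [K], and [B] is injective. *)
Lemma separable_ode_unique (G K psi1 psi2 D1 D2 : R -> R) (a : R) :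
  (forall y, 0 < y -> continuous G y) -> (forall y, 0 < y -> 0 < G y) ->
  (forall x, 0 < x -> 0 < psi1 x /\ is_derive psi1 x (D1 x) /\ G (psi1 x) * D1 x = K x) ->
  (forall x, 0 < x -> 0 < psi2 x /\ is_derive psi2 x (D2 x) /\ G (psi2 x) * D2 x = K x) ->
  0 < a -> psi1 a = psi2 a ->
  forall x, 0 < x -> psi1 x = psi2 x.
Proof.
  intros HG HGp H1 H2 Ha Hab x Hx.
  destruct (antiderivative_open_half_line G HG) as [B HB].
  assert (Hcomp : forall psi D, (forall z, 0 < z ->
      0 < psi z /\ is_derive psi z (D z) /\ G (psi z) * D z = K z) ->
    forall z, 0 < z -> is_derive (fun t => B (psi t)) z (K z)).
  { intros psi D Hpsi z Hz. destruct (Hpsi z Hz) as [Hp [Hd <-]].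
    rewrite Rmult_comm. apply (is_derive_comp B psi); [apply HB, Hp | exact Hd]. }
  destruct (mean_value_open_half_line (fun t => B (psi1 t) - B (psi2 t))
              (fun t => K t - K t) a x) as [c [_ Ec]]; try assumption.
  { intros z Hz. apply (is_derive_minus (fun t => B (psi1 t)) (fun t => B (psi2 t))).
    - apply (Hcomp psi1 D1); assumption.
    - apply (Hcomp psi2 D2); assumption. }
  rewrite Hab in Ec.
  destruct (mean_value_open_half_line B G (psi1 x) (psi2 x)) as [e [He Ee]];
    [exact HB | apply H1, Hx | apply H2, Hx |].
  assert (E0 : G e * (psi2 x - psi1 x) = 0) by lra.
  specialize (HGp e He).
  apply Rmult_integral in E0. destruct E0; lra.
Qed.

(** * The function [Phi_+] as a conjugacy *)

(** By the shift rule for [H1] both sides solve the same separable equation,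
    and they agree at [a]. *)
Lemma Phi_plus_semiconjugates (f g phi : R -> R) (a alpha : R) :
  S_minus f -> S_minus g -> condition_P f g -> 0 < a ->
  is_Phi_plus f g a alpha phi ->
  forall x, 0 < x -> phi (f x) = g (phi x).
Proof.
  intros Hf Hg HP Ha [lambda [Hlambda [[Hphi Hphia] Hfa]]].
  apply (separable_ode_unique (fun xi => H1 g g xi 1)
    (fun x => H1 f g (f x) 1 * lambda * Derive f x)
    (fun x => phi (f x)) (fun x => g (phi x))
    (fun x => Derive f x * (H1 f g (f x) (phi (f x)) * lambda))
    (fun x => H1 f g x (phi x) * lambda * Derive g (phi x)) a).
  - intros y Hy. apply self_product_continuous; try assumption. lra.
  - intros y Hy. apply self_product_limit; try assumption. lra.
  - intros x Hx. pose proof (S_minus_pos f x Hf Hx) as Hfx.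
    destruct (Hphi (f x) Hfx) as [Hp Hd]. split; [exact Hp|]. split.
    + apply (is_derive_comp phi f); [exact Hd | apply S_minus_is_derive; assumption].
    + rewrite <- (H1_separated f g (f x) (phi (f x)) 1); try assumption; [ring | lra].
  - intros x Hx. pose proof (S_minus_pos f x Hf Hx) as Hfx.
    destruct (Hphi x Hx) as [Hp Hd]. pose proof (S_minus_pos g _ Hg Hp) as Hgp.
    split; [exact Hgp|]. split.
    + apply (is_derive_comp g phi); [apply S_minus_is_derive; assumption | exact Hd].
    + rewrite <- (H1_shift f g x (phi x)) by assumption.
      rewrite <- (H1_separated f g (f x) (g (phi x)) 1); try assumption; [|lra].
      field. apply Rgt_not_eq, S_minus_Derive_pos; assumption.
  - exact Ha.
  - rewrite Hphia. exact Hfa.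
Qed.

Lemma semiconjugacy_iterates (f g phi : R -> R) (x : R) (n : nat) :
  S_minus f -> (forall y, 0 < y -> phi (f y) = g (phi y)) -> 0 < x ->
  phi (Nat.iter n f x) = Nat.iter n g (phi x).
Proof.
  intros Hf H Hx. induction n as [|n IH]; simpl; [reflexivity|].
  rewrite H, IH; [reflexivity | apply orbit_pos; assumption].
Qed.

(** Since [f] is onto, [g s] would bound [phi] along with its supremum [s],
    but [g s < s]. *)
Lemma semiconjugacy_unbounded (f g phi : R -> R) :
  S_minus f -> S_minus g -> (forall x, 0 < x -> 0 < phi x) ->
  (forall x, 0 < x -> phi (f x) = g (phi x)) ->
  forall M, exists x, 0 < x /\ M < phi x.
Proof.
  intros Hf Hg Hpos Hconj M.
  apply NNPP. intros Hno.
  assert (Hbd : forall x, 0 < x -> phi x <= M).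
  { intros x Hx. apply Rnot_lt_le. intros HM. apply Hno. exists x. auto. }
  destruct (completeness (fun y => exists x, 0 < x /\ y = phi x)) as [s [Hub Hlub]].
  - exists M. intros y [x [Hx ->]]. auto.
  - exists (phi 1), 1. split; [lra | reflexivity].
  - assert (Hs : 0 < s).
    { apply Rlt_le_trans with (phi 1); [apply Hpos; lra|].
      apply Hub. exists 1. split; [lra | reflexivity]. }
    destruct (S_minus_data f Hf) as [_ [_ [_ [Hf0 _]]]].
    assert (Hle : s <= g s).
    { apply Hlub. intros y [x [Hx ->]].
      destruct Hf as [[finv [Hinv _]] _].
      assert (Hx' : half_line x) by (unfold half_line; lra).
      destruct (Hinv x Hx') as [_ [Hz [_ Efz]]].
      destruct Hz as [Hz|Hz].
      - rewrite <- Efz, Hconj by exact Hz.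
        apply (orbit_monotone g _ _ 1 Hg (Hpos _ Hz)).
        apply Hub. exists (finv x). auto.
      - rewrite <- Hz in Efz. lra. }
    pose proof (proj2 Hg s Hs). lra.
Qed.

Lemma extend_by_0_pos (phi : R -> R) (x : R) : 0 < x -> extend_by_0 phi x = phi x.
Proof. intros Hx. unfold extend_by_0. destruct Rlt_dec; [reflexivity | lra]. Qed.

Lemma extend_by_0_at_0 (phi : R -> R) : extend_by_0 phi 0 = 0.
Proof. unfold extend_by_0. destruct Rlt_dec; [lra | reflexivity]. Qed.

Lemma smooth_Phi_plus_conjugate (f g phi : R -> R) (a alpha : R) :
  S_minus f -> S_minus g -> condition_P f g -> 0 < a ->
  is_Phi_plus f g a alpha phi -> smooth (extend_by_0 phi) ->
  conjugate f g.
Proof.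
  intros Hf Hg HP Ha HPhi [d Hd].
  pose proof (Phi_plus_semiconjugates f g phi a alpha Hf Hg HP Ha HPhi) as Hconj.
  destruct HPhi as [lambda [Hlambda [[Hphi _] _]]].
  assert (Hpos : forall x, 0 < x -> 0 < phi x) by (intros x Hx; apply Hphi, Hx).
  assert (Hd1 : forall x, 0 < x -> d 1%nat x = H1 f g x (phi x) * lambda).
  { intros x Hx.
    rewrite <- (is_derive_unique phi x _ (proj2 (Hphi x Hx))).
    symmetry. apply is_derive_unique.
    apply (is_derive_ext_loc (extend_by_0 phi)).
    - apply (filter_imp (fun t => 0 < t)); [intros t Ht | apply locally_pos; lra].
      apply extend_by_0_pos. lra.
    - apply derivative_sequence_is_derive; assumption. }
  (* The derivative at 0 is read off along an orbit, where [H1] tends to 1. *)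
  assert (Hd0 : d 1%nat 0 = lambda).
  { assert (L1 : is_lim_seq (fun n => d 1%nat (Nat.iter n f 1)) (d 1%nat 0)).
    { apply (is_lim_seq_half_line (d 1%nat) (d 2%nat)).
      - apply (proj2 Hd).
      - intros n. left. apply orbit_pos; [exact Hf | lra].
      - unfold half_line. lra.
      - apply orbit_tends_to_0; [exact Hf | lra]. }
    assert (L2 : is_lim_seq (fun n => d 1%nat (Nat.iter n f 1)) (1 * lambda)).
    { apply (is_lim_seq_ext
        (fun n => H1 f g (Nat.iter n f 1) (Nat.iter n g (phi 1)) * lambda)).
      - intros n. rewrite Hd1 by (apply orbit_pos; [exact Hf | lra]).
        rewrite (semiconjugacy_iterates f g phi 1 n Hf Hconj Rlt_0_1). reflexivity.
      - apply is_lim_seq_mult'; [|apply is_lim_seq_const].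
        apply H1_along_orbits; try assumption; [lra | apply Hpos; lra]. }
    apply is_lim_seq_unique in L1. apply is_lim_seq_unique in L2.
    rewrite L1 in L2. injection L2 as E. lra. }
  assert (Hdpos : forall x, half_line x -> 0 < d 1%nat x).
  { intros x [Hx|Hx].
    - rewrite Hd1 by exact Hx. apply Rmult_lt_0_compat; [|exact Hlambda].
      apply H1_limit; auto.
    - rewrite <- Hx, Hd0. exact Hlambda. }
  destruct (unbounded_diffeo (extend_by_0 phi) d Hd Hdpos (extend_by_0_at_0 phi))
    as [hinv Hh].
  { intros M.
    destruct (semiconjugacy_unbounded f g phi Hf Hg Hpos Hconj M) as [x [Hx HM]].
    exists x. rewrite extend_by_0_pos; auto. }
  exists (extend_by_0 phi), hinv. split; [exact Hh|].
  destruct (S_minus_data f Hf) as [_ [_ [_ [Hf0 _]]]].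
  destruct (S_minus_data g Hg) as [_ [_ [_ [Hg0 _]]]].
  assert (Hleft : forall y, half_line y -> hinv (extend_by_0 phi y) = y)
    by (intros y Hy; apply Hh, Hy).
  intros x [Hx|Hx].
  - pose proof (S_minus_pos f x Hf Hx) as Hfx.
    rewrite (extend_by_0_pos phi x Hx), <- (Hconj x Hx).
    rewrite <- (extend_by_0_pos phi (f x) Hfx).
    symmetry. apply Hleft. left. exact Hfx.
  - rewrite <- Hx, extend_by_0_at_0, Hf0, Hg0.
    rewrite <- (extend_by_0_at_0 phi) at 2.
    symmetry. apply Hleft. right. reflexivity.
Qed.

(** * Conjugacies solve the initial-value problem *)

(** By the chain rule the quotients [f' / g'] along the orbits are quotients of
    values of [h'], and the product telescopes. *)
Lemma H1_partial_of_conjugacy (f g h : R -> R) (d : nat -> R -> R) (x : R) (N : nat) :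
  S_minus f -> S_minus g -> derivative_sequence h d ->
  (forall y, 0 < y -> 0 < h y) ->
  (forall y, 0 < y -> h (f y) = g (h y)) -> 0 < x ->
  H1_partial f g x (h x) N * d 1%nat (Nat.iter (S N) f x) = d 1%nat x.
Proof.
  intros Hf Hg Hd Hpos Hconj Hx.
  assert (Hchain : forall y, 0 < y ->
    Derive f y / Derive g (h y) * d 1%nat (f y) = d 1%nat y).
  { intros y Hy. pose proof (S_minus_Derive_pos g _ Hg (Hpos y Hy)) as Hgp.
    assert (D1 : is_derive (fun t => h (f t)) y (Derive f y * d 1%nat (f y))).
    { apply (is_derive_comp h f).
      - apply derivative_sequence_is_derive; [exact Hd|]. apply S_minus_pos; assumption.
      - apply S_minus_is_derive; assumption. }
    assert (D2 : is_derive (fun t => h (f t)) y (d 1%nat y * Derive g (h y))).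
    { apply (is_derive_ext_loc (fun t => g (h t))).
      - apply (filter_imp (fun t => 0 < t)); [intros t Ht | apply locally_pos; lra].
        symmetry. apply Hconj. lra.
      - apply (is_derive_comp g h).
        + apply S_minus_is_derive; auto.
        + apply derivative_sequence_is_derive; assumption. }
    apply is_derive_unique in D1. apply is_derive_unique in D2.
    rewrite D1 in D2.
    replace (Derive f y / Derive g (h y) * d 1%nat (f y))
      with (Derive f y * d 1%nat (f y) / Derive g (h y)) by (field; lra).
    rewrite D2. field. lra. }
  induction N as [|N IH].
  - apply Hchain, Hx.
  - rewrite <- IH, <- (Hchain (Nat.iter (S N) f x) (orbit_pos f x (S N) Hf Hx)).
    unfold H1_partial. cbn [prod_f_R0].
    rewrite (semiconjugacy_iterates f g h x (S N) Hf Hconj Hx).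
    simpl. ring.
Qed.

Lemma conjugacy_is_Phi_plus (f g h hinv : R -> R) :
  S_minus f -> S_minus g -> diffeo_with_inverse h hinv ->
  (forall x, half_line x -> f x = hinv (g (h x))) ->
  condition_P f g /\
  (forall a, 0 < a -> 0 < h a /\ is_Phi_plus f g a (h a) h) /\
  smooth (extend_by_0 h).
Proof.
  intros Hf Hg Hh Hfgh.
  destruct (diffeo_increasing_data h hinv Hh) as [d [Hd [Hdpos Hh0]]].
  assert (Hpos : forall y, 0 < y -> 0 < h y).
  { intros y Hy. rewrite <- Hh0. apply (increasing_half_line h (d 1%nat)); try lra.
    - intros z Hz. apply derivative_sequence_D_in; assumption.
    - exact Hdpos. }
  assert (Hconj : forall y, 0 < y -> h (f y) = g (h y)).
  { intros y Hy. rewrite Hfgh by (unfold half_line; lra).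
    apply Hh. left. apply S_minus_pos; auto. }
  assert (Hd0 : 0 < d 1%nat 0) by (apply Hdpos; unfold half_line; lra).
  assert (Hlim : forall x, 0 < x ->
    is_lim_seq (H1_partial f g x (h x)) (d 1%nat x / d 1%nat 0)).
  { intros x Hx.
    apply (is_lim_seq_ext (fun n => d 1%nat x / d 1%nat (Nat.iter (S n) f x))).
    - intros n. rewrite <- (H1_partial_of_conjugacy f g h d x n) by assumption.
      field. apply Rgt_not_eq, Hdpos. left. apply orbit_pos; assumption.
    - apply is_lim_seq_div'; [apply is_lim_seq_const | | lra].
      apply (is_lim_seq_incr_1 (fun n => d 1%nat (Nat.iter n f x))).
      apply (is_lim_seq_half_line (d 1%nat) (d 2%nat)).
      + apply (proj2 Hd).
      + intros n. left. apply orbit_pos; assumption.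
      + unfold half_line. lra.
      + apply orbit_tends_to_0; assumption. }
  split; [|split].
  - exists 1, (h 1). split; [lra|]. split; [apply Hpos; lra|].
    exists (d 1%nat 1 / d 1%nat 0). split; [|apply Hlim; lra].
    apply Rgt_not_eq, Rdiv_lt_0_compat; [|exact Hd0].
    apply Hdpos. unfold half_line. lra.
  - intros a Ha. split; [apply Hpos, Ha|].
    exists (d 1%nat 0). split; [exact Hd0|]. split; [split|].
    + intros x Hx. split; [apply Hpos, Hx|].
      unfold H1. rewrite (is_lim_seq_unique _ _ (Hlim x Hx)). simpl.
      replace (d 1%nat x / d 1%nat 0 * d 1%nat 0) with (d 1%nat x) by (field; lra).
      apply derivative_sequence_is_derive; assumption.
    + reflexivity.
    + apply Hconj, Ha.
  - exists d. split; [|apply (proj2 Hd)].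
    intros x [Hx|Hx].
    + rewrite extend_by_0_pos by exact Hx. apply (proj1 Hd). left. exact Hx.
    + rewrite <- Hx, extend_by_0_at_0, (proj1 Hd) by (unfold half_line; lra).
      exact Hh0.
Qed.

Theorem theorem2p5 (f g : R -> R) (hf : S_minus f) (hg : S_minus g) :
  conjugate f g <->
  (condition_P f g /\
   exists a alpha : R, 0 < a /\ 0 < alpha /\
     exists phi : R -> R,
       is_Phi_plus f g a alpha phi /\ smooth (extend_by_0 phi)).
Proof.
  split.
  - intros [h [hinv [Hh Hfgh]]].
    destruct (conjugacy_is_Phi_plus f g h hinv hf hg Hh Hfgh) as [HP [Hphi Hsmooth]].
    destruct (Hphi 1 Rlt_0_1) as [Hh1 HPhi].
    split; [exact HP|].
    exists 1, (h 1). split; [lra|]. split; [exact Hh1|].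
    exists h. split; assumption.
  - intros [HP [a [alpha [Ha [_ [phi [HPhi Hsmooth]]]]]]].
    exact (smooth_Phi_plus_conjugate f g phi a alpha hf hg HP Ha HPhi Hsmooth).
Qed.
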